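(* Let $G$ be the free nilpotent group of rank $n\geq 2$ and nilpotency class $c\ge 1$. Then the Nielsen graph $\Gamma_n(G)$ is connected if and only if $c=1$ or $c=2$.
   Context: The free nilpotent group of rank $n$ and class $c$ is $F_n/\gamma_{c+1}F_n$, where $F_n$ is the free group of rank $n$, and $\gamma_1F_n=F_n$, $\gamma_{i+1}F_n=[F_n,\gamma_iF_n]$ is its lower central series. For a finitely generated group $G$ and $n\ge \operatorname{rank}(G)$ (the minimal number of generators of $G$), the Nielsen graph $\Gamma_n(G)$ has as vertices the generating $n$-tuples $(g_1,\dots,g_n)\in G^n$, $\langle g_1,\dots,g_n\rangle=G$; two vertices are joined by an edge if one is obtained from the other by an elementary Nielsen move, i.e. by replacing $x_i$ by $x_ix_j^{\pm1}$ or by $x_j^{\pm1}x_i$ for some $j\ne i$, or by replacing $x_j$ by $x_j^{-1}$, the other entries being unchanged. *)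

(* Defs.v *)
From HB Require Import structures.
From mathcomp Require Import all_boot.
From mathcomp Require Import boolp classical_sets.
From Stdlib Require Import Relation_Operators.

Set Implicit Arguments.
Unset Strict Implicit.
Unset Printing Implicit Defensive.

Local Open Scope group_scope.
Local Open Scope classical_set_scope.

Section Words.
Variable T : choiceType.
Implicit Types (a b : T * bool) (u v w : seq (T * bool)).

(* The letter (t, false) stands for the generator t and (t, true) for its     *)
(* inverse.                                                                   *)
Definition inv_letter a : T * bool := (a.1, ~~ a.2).

Definition reduced w : bool := sorted (fun a b => b != inv_letter a) w.

Definition cons_red a w : seq (T * bool) :=
  if w is b :: w' then if b == inv_letter a then w' else a :: w else [:: a].

(* The reduced form of u ++ w, provided that w is reduced.                    *)
Definition cat_red u w : seq (T * bool) := foldr cons_red w u.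

Definition inv_word w : seq (T * bool) := rev (map inv_letter w).

Lemma inv_letterK : involutive inv_letter.
Proof. by case=> t s; rewrite /inv_letter negbK. Qed.

Lemma cons_red_reduced a w : reduced w -> reduced (cons_red a w).
Proof.
case: w => [//|b w] /= rw; case: ifP => [_|/negbT nab].
  by case: w rw => //= c w /andP[].
by rewrite /reduced /= nab.
Qed.

Lemma cat_red_reduced u w : reduced w -> reduced (cat_red u w).
Proof. by move=> rw; elim: u => //= a u; apply: cons_red_reduced. Qed.

Lemma cons_redK a w : reduced w -> cons_red a (cons_red (inv_letter a) w) = w.
Proof.
case: w => [|b w] /= rw; first by rewrite eqxx.
rewrite inv_letterK; case: eqP => [ba|_]; last by rewrite /= eqxx.
subst b; case: w rw => //= b w /andP[nba _].
by rewrite (negbTE nba).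
Qed.

Lemma cat_red_cons a v w : reduced w ->
  cat_red (cons_red a v) w = cons_red a (cat_red v w).
Proof.
case: v => [//|b v] rw /=; case: eqP => [->|//].
by rewrite cons_redK // cat_red_reduced.
Qed.

Lemma cat_redA u v w : reduced w ->
  cat_red u (cat_red v w) = cat_red (cat_red u v) w.
Proof. by move=> rw; elim: u => //= a u ->; rewrite cat_red_cons. Qed.

Lemma cat_reds0 w : reduced w -> cat_red w [::] = w.
Proof.
elim: w => //= a w IHw rw; rewrite IHw; last by apply: path_sorted rw.
by case: w rw {IHw} => //= b w /andP[/negbTE -> _].
Qed.

Lemma inv_word_reduced w : reduced w -> reduced (inv_word w).
Proof.
rewrite /reduced /inv_word rev_sorted sorted_map; apply: sub_sorted => a b /=.
by rewrite inv_letterK; apply: contra => /eqP ->.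
Qed.

Lemma inv_wordK : involutive inv_word.
Proof.
move=> w; rewrite /inv_word map_rev revK -map_comp -[RHS]map_id.
by apply: eq_map => a /=; apply: inv_letterK.
Qed.

Lemma cat_redVs w : reduced w -> cat_red (inv_word w) w = [::].
Proof.
elim: w => //= a w IHw rw.
rewrite /cat_red /inv_word map_cons rev_cons foldr_rcons /= inv_letterK eqxx.
by apply: IHw; apply: path_sorted rw.
Qed.

End Words.

(* The free group on T, realised as the reduced words over T and its formal   *)
(* inverses.                                                                  *)
Record freegroup (T : choiceType) := FreeGroup {
  word :> seq (T * bool);
  word_reduced : reduced word
}.

HB.instance Definition _ (T : choiceType) := [isSub for @word T].
HB.instance Definition _ (T : choiceType) := [Choice of freegroup T by <:].

Definition freegroup_gen (T : choiceType) (t : T) : freegroup T :=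
  @FreeGroup T [:: (t, false)] isT.

Section FreeGroup.
Variable T : choiceType.
Implicit Types x y z : freegroup T.

Let fone : freegroup T := @FreeGroup T [::] isT.
Let fmul x y : freegroup T := FreeGroup (cat_red_reduced x (word_reduced y)).
Let finv x : freegroup T := FreeGroup (inv_word_reduced (word_reduced x)).

Let fmulA : associative fmul.
Proof. by move=> x y z; apply: val_inj; apply: cat_redA; apply: word_reduced. Qed.
Let fmul1g : left_id fone fmul.
Proof. by move=> x; apply: val_inj. Qed.
Let fmulg1 : right_id fone fmul.
Proof. by move=> x; apply: val_inj; apply: cat_reds0; apply: word_reduced. Qed.
Let fmulVg : left_inverse fone finv fmul.
Proof. by move=> x; apply: val_inj; apply: cat_redVs; apply: word_reduced. Qed.
Let fmulgV : right_inverse fone finv fmul.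
Proof.
move=> x; have <- := fmulVg (finv x); congr fmul.
by apply: val_inj; rewrite /= inv_wordK.
Qed.

HB.instance Definition _ :=
  isGroup.Build (freegroup T) fmulA fmul1g fmulg1 fmulVg fmulgV.

End FreeGroup.

Section Subgroups.
Variable G : groupType.
Implicit Types (H K S : set G) (x y : G).

Record is_subgroup H : Prop := IsSubgroup {
  subgroup1 : H 1;
  subgroupM : forall x y, H x -> H y -> H (x * y);
  subgroupV : forall x, H x -> H x^-1
}.

Record is_normal_subgroup H : Prop := IsNormalSubgroup {
  normal_subgroup : is_subgroup H;
  normal_conj : forall x y, H x -> H (x ^ y)
}.

Definition generated S : set G := smallest is_subgroup S.

Definition commutator H K : set G :=
  generated [set z | exists x y, [/\ H x, K y & z = [~ x, y]]].

(* gamma i is the i-th term of the lower central series, indexed from 1:      *)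
(* gamma 1 = G and gamma i.+1 = [G, gamma i] for 1 <= i; the junk value       *)
(* gamma 0 is G.                                                              *)
Definition gamma (i : nat) : set G := iter i.-1 (commutator setT) setT.

Lemma generated_subgroup S : is_subgroup (generated S).
Proof.
split=> [H [sH _]|x y Sx Sy H HP|x Sx H HP].
- exact: subgroup1.
- by apply: (subgroupM HP.1); [apply: Sx | apply: Sy].
- by apply: (subgroupV HP.1); apply: Sx.
Qed.

Lemma generated_normal S :
  (forall x y, S x -> S (x ^ y)) -> is_normal_subgroup (generated S).
Proof.
move=> SJ; have sgS := generated_subgroup S.
split=> // x y; move: x.
apply: (@smallest_sub _ _ _ [set x | generated S (x ^ y)]).
  split=> [|x z Sx Sz|x Sx] /=.
  - by rewrite conj1g; apply: (subgroup1 sgS).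
  - by rewrite conjMg; apply: (subgroupM sgS).
  - by rewrite conjVg; apply: (subgroupV sgS).
by move=> x Sx; apply: sub_gen_smallest; apply: SJ.
Qed.

Lemma gamma_normal i : is_normal_subgroup (gamma i).
Proof.
rewrite /gamma; elim: i.-1 => {i} [//|i IHi].
apply: generated_normal => _ y [x [z [_ Hz ->]]].
exists (x ^ y), (z ^ y); split=> //; first by apply: normal_conj IHi _ _ Hz.
by rewrite conjRg.
Qed.

End Subgroups.

Record normalSubgroup (G : groupType) := NormalSubgroup {
  normal_set :> G -> Prop;
  normal_setP : is_normal_subgroup normal_set
}.

Section Quotient.
Variables (G : groupType) (N : normalSubgroup G).
Implicit Types x y z : G.

Local Open Scope quotient_scope.

Let sN : is_subgroup N := normal_subgroup (normal_setP N).

Definition coset_rel : rel G := fun x y => `[< N (x^-1 * y) >].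

Let coset_rel_refl : reflexive coset_rel.
Proof. by move=> x; apply/asboolP; rewrite mulVg; apply: (subgroup1 sN). Qed.
Let coset_rel_sym : symmetric coset_rel.
Proof.
have half x y : coset_rel x y -> coset_rel y x.
  move=> /asboolP Nxy; apply/asboolP.
  by have := subgroupV sN Nxy; rewrite invgM invgK.
by move=> x y; apply/idP/idP; apply: half.
Qed.
Let coset_rel_trans : transitive coset_rel.
Proof.
move=> y x z /asboolP Nxy /asboolP Nyz; apply/asboolP.
by have := subgroupM sN Nxy Nyz; rewrite mulgA mulgK.
Qed.

Canonical coset_equiv : equiv_rel G :=
  EquivRel coset_rel coset_rel_refl coset_rel_sym coset_rel_trans.

Definition quotient_group : Type := {eq_quot coset_equiv}.

HB.instance Definition _ := Choice.on quotient_group.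
HB.instance Definition _ := EqQuotient.on quotient_group.

Definition coset (x : G) : quotient_group := \pi_quotient_group x.

Lemma cosetP x y : coset x = coset y <-> N (x^-1 * y).
Proof.
rewrite /coset; split=> [/eqquotP/asboolP //|Nxy].
by apply/eqquotP/asboolP.
Qed.

Lemma repr_coset x : N (x^-1 * repr (coset x)).
Proof. by apply/cosetP; rewrite /coset reprK. Qed.

Let qone : quotient_group := coset 1.
Let qmul (a b : quotient_group) : quotient_group := coset (repr a * repr b).
Let qinv (a : quotient_group) : quotient_group := coset (repr a)^-1.

Let qmulE x y : qmul (coset x) (coset y) = coset (x * y).
Proof.
apply/esym/cosetP.
set a := repr _; set b := repr _.
have Na : N ((x^-1 * a) ^ y).
  by apply: (normal_conj (normal_setP N)); apply: repr_coset.
have := subgroupM sN Na (repr_coset y).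
by rewrite -/b conjgE invgM !mulgA mulgK.
Qed.

Let qinvE x : qinv (coset x) = coset x^-1.
Proof.
apply/cosetP; rewrite invgK.
have := normal_conj (normal_setP N) x^-1 (repr_coset x).
by rewrite conjgE invgK !mulgA mulgV mul1g.
Qed.

Let cosetK (a : quotient_group) : coset (repr a) = a.
Proof. by rewrite /coset reprK. Qed.

Let qmulA : associative qmul.
Proof.
by move=> a b c; rewrite -(cosetK a) -(cosetK b) -(cosetK c) !qmulE mulgA.
Qed.
Let qmul1g : left_id qone qmul.
Proof. by move=> a; rewrite -(cosetK a) qmulE mul1g. Qed.
Let qmulg1 : right_id qone qmul.
Proof. by move=> a; rewrite -(cosetK a) qmulE mulg1. Qed.
Let qmulVg : left_inverse qone qinv qmul.
Proof. by move=> a; rewrite -(cosetK a) qinvE qmulE mulVg. Qed.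
Let qmulgV : right_inverse qone qinv qmul.
Proof. by move=> a; rewrite -(cosetK a) qinvE qmulE mulgV. Qed.

HB.instance Definition _ :=
  isGroup.Build quotient_group qmulA qmul1g qmulg1 qmulVg qmulgV.

Lemma cosetM x y : coset (x * y) = coset x * coset y.
Proof. by rewrite -qmulE. Qed.

Lemma cosetV x : coset x^-1 = (coset x)^-1.
Proof. by rewrite -qinvE. Qed.

End Quotient.

Definition free_nilpotent (n c : nat) : groupType :=
  quotient_group (NormalSubgroup (gamma_normal (freegroup 'I_n) c.+1)).

Section NielsenGraph.
Variables (G : groupType) (n : nat).
Implicit Types g h : {ffun 'I_n -> G}.

Definition generating_tuple g : Prop := generated (range g) = setT.

Definition set_entry g (i : 'I_n) (x : G) : {ffun 'I_n -> G} :=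
  [ffun k => if k == i then x else g k].

Inductive nielsen_move g : {ffun 'I_n -> G} -> Prop :=
| Nielsen_mulr i j of j != i : nielsen_move g (set_entry g i (g i * g j))
| Nielsen_mulrV i j of j != i : nielsen_move g (set_entry g i (g i * (g j)^-1))
| Nielsen_mull i j of j != i : nielsen_move g (set_entry g i (g j * g i))
| Nielsen_mullV i j of j != i : nielsen_move g (set_entry g i ((g j)^-1 * g i))
| Nielsen_inv j : nielsen_move g (set_entry g j (g j)^-1).

Definition nielsen_edge g h : Prop :=
  [/\ generating_tuple g, generating_tuple h
    & nielsen_move g h \/ nielsen_move h g].

End NielsenGraph.

Definition free_nilpotent_basis (n c : nat) :
    {ffun 'I_n -> free_nilpotent n c} :=
  [ffun i => coset _ (freegroup_gen i)].

Lemma free_nilpotent_basisP n c : generating_tuple (free_nilpotent_basis n c).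
Proof.
rewrite /generating_tuple; set H := generated _.
have sH : is_subgroup H by apply: generated_subgroup.
pose N := NormalSubgroup (gamma_normal (freegroup 'I_n) c.+1).
suff HN (x : freegroup 'I_n) : H (coset N x).
  apply/seteqP; split=> // a _.
  by have := HN (repr (a : quotient_group N)); rewrite /coset reprK.
case: x => w rw; elim: w rw => [|[i s] w IHw] rw.
  have -> : FreeGroup rw = 1 by apply/val_eqP.
  exact: (subgroup1 sH).
have rw' : reduced w by apply: path_sorted rw.
have Hi : H (coset N (freegroup_gen i)).
  by apply: sub_gen_smallest; exists i => //; rewrite ffunE.
pose l := if s then (freegroup_gen i)^-1 else freegroup_gen i.
have -> : FreeGroup rw = l * FreeGroup rw'.
  have lE : word l = [:: (i, s)] by rewrite /l; case: (s).
  apply/val_eqP; rewrite /= lE /=.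
  by case: w rw {IHw rw'} => //= b w /andP[/negbTE -> _].
rewrite cosetM; apply: (subgroupM sH) (IHw rw').
by rewrite /l; case: (s) => //; rewrite cosetV; apply: (subgroupV sH).
Qed.

Definition graph_connected (V : Type) (vertex : set V) (edge : V -> V -> Prop) :
    Prop :=
  forall x y, vertex x -> vertex y -> clos_refl_trans V edge x y.

Definition nielsen_graph_connected (n : nat) (G : groupType) : Prop :=
  graph_connected (@generating_tuple G n) (@nielsen_edge G n).

(* Main.v *)
(* Let x_1, ..., x_n be the standard basis of G.

   Class at most 2: on exponent sums, Nielsen moves are the elementary row
   operations over Z, so Euclid's algorithm, column by column, brings every
   generating tuple to the form (x_i z_i) with z_i in gamma 2, which is central.
   Right multiplication of one entry by a commutator [x_j, x_k] is a composition
   of moves (a conjugation when j or k is the index of that entry), and gamma 2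
   is generated by these commutators because the commutator is bilinear.

   Class at least 3: let R = Z[t]/(t^3) and let x_2 act on R^n as exp(2t), the
   other x_i trivially. Sending x_i to the standard vector e_i extends to a
   crossed homomorphism G -> R^n (a Fox derivative): it vanishes on gamma 4
   because exp(2kt) - 1 lies in tR. A Nielsen move changes the determinant of
   the n vectors attached to a tuple by a factor +/- exp(2kt). The tuple (x_1 [[x_1, x_2], x_2], x_2, ..., x_n)
   generates G by nilpotency, but its determinant 1 + 4t^2 is not of that form. *)
From HB Require Import structures.
From mathcomp Require Import all_boot all_order all_algebra.
From mathcomp Require Import boolp classical_sets.
From mathcomp Require Import ring zify.
From Stdlib Require Import Relation_Operators.
Require Import Defs.

Set Implicit Arguments.
Unset Strict Implicit.
Unset Printing Implicit Defensive.

Import GRing.Theory.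
Local Open Scope group_scope.
Local Open Scope classical_set_scope.

(** * Generated subgroups and homomorphisms out of free groups and quotients *)

Section Generation.
Variable G : groupType.
Implicit Types (S H : set G).

Lemma generated_sub S H : is_subgroup H -> S `<=` H -> generated S `<=` H.
Proof. by move=> sH SH; apply: smallest_sub. Qed.

Lemma sub_generated S : S `<=` generated S.
Proof. exact: sub_gen_smallest. Qed.

Lemma sub_gammaSS i H : is_subgroup H ->
  (forall x y : G, gamma i.+1 y -> H [~ x, y]) -> gamma i.+2 `<=` H.
Proof.
move=> sH HR; apply: generated_sub => // z [x [y [_ Gy ->]]]; exact: HR.
Qed.

Lemma gammaR i (x y : G) : gamma i.+1 y -> gamma i.+2 [~ x, y].
Proof. by move=> Gy; apply: sub_generated; exists x, y. Qed.

End Generation.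

Section Morphisms.
Variables (G A : groupType) (f : UMagmaMorphism.type G A).

Lemma morph_subgroup_preim (H : set A) : is_subgroup H -> is_subgroup (f @^-1` H).
Proof.
move=> sH; split=> [|x y|x] /=.
- by rewrite gmulf1; apply: subgroup1.
- by rewrite gmulfM; apply: subgroupM.
- by rewrite gmulfV; apply: subgroupV.
Qed.

End Morphisms.

Section FreeGroupHom.
Variables (T : choiceType) (A : groupType) (phi : T -> A).

Definition letter_image (a : T * bool) : A := if a.2 then (phi a.1)^-1 else phi a.1.

Definition free_hom (x : freegroup T) : A :=
  \prod_(a <- word x) letter_image a.

Lemma prod_cons_red a w :
  \prod_(b <- cons_red a w) letter_image b =
    letter_image a * \prod_(b <- w) letter_image b.
Proof.
case: w => [|b w] /=; first by rewrite !big_cons.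
case: eqP => [->|_]; last by rewrite !big_cons.
rewrite big_cons mulgA; case: a => t [] /=; rewrite /letter_image /=.
  by rewrite mulVg mul1g.
by rewrite mulgV mul1g.
Qed.

Lemma free_hom_monoid_morphism : monoid.monoid_morphism free_hom.
Proof.
split=> [|x y]; first by rewrite /free_hom big_nil.
rewrite /free_hom /=; elim: (word x) => [|a w IHw] /=; first by rewrite big_nil mul1g.
by rewrite prod_cons_red big_cons IHw mulgA.
Qed.

HB.instance Definition _ :=
  isUMagmaMorphism.Build (freegroup T) A free_hom free_hom_monoid_morphism.

Lemma free_homR x y : free_hom [~ x, y] = [~ free_hom x, free_hom y].
Proof. exact: gmulfR. Qed.

Lemma free_hom_gen t : free_hom (freegroup_gen t) = phi t.
Proof. by rewrite /free_hom big_seq1. Qed.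

End FreeGroupHom.

Section QuotientHom.
Variables (G : groupType) (N : normalSubgroup G) (A : groupType).
Variable f : UMagmaMorphism.type G A.

(** Defined through representatives for every [f]; the value on a coset is independent of the choice
    once [f] kills [N]. *)
Definition quotient_hom (a : quotient_group N) : A := f (repr a).

Lemma coset_surj (a : quotient_group N) : exists x, a = coset N x.
Proof. by exists (repr a); rewrite /coset reprK. Qed.

Lemma coset_monoid_morphism : monoid.monoid_morphism (coset N).
Proof. by split=> // x y; apply: cosetM. Qed.

Hypothesis fN : forall x, N x -> f x = 1.

Lemma quotient_hom_coset x : quotient_hom (coset N x) = f x.
Proof.
have /fN := repr_coset N x; rewrite gmulfM gmulfV => fx.
by rewrite /quotient_hom -[LHS](mulVKg (f x)) fx mulg1.
Qed.

Lemma quotient_homM : {morph quotient_hom : a b / a * b}.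
Proof.
move=> a b; have [x ->] := coset_surj a; have [y ->] := coset_surj b.
by rewrite -cosetM !quotient_hom_coset gmulfM.
Qed.

End QuotientHom.

HB.instance Definition _ (G : groupType) (N : normalSubgroup G) :=
  isUMagmaMorphism.Build G (quotient_group N) (coset N) (coset_monoid_morphism N).

Lemma cosetR (G : groupType) (N : normalSubgroup G) (x y : G) :
  coset N [~ x, y] = [~ coset N x, coset N y].
Proof. exact: gmulfR. Qed.

(** * Paths in the Nielsen graph *)

Section NielsenReach.
Variables (G : groupType) (n : nat).
Implicit Types (g h : {ffun 'I_n -> G}).

Definition reach := clos_refl_trans _ (@nielsen_edge G n).

Lemma reach_trans g h k : reach g h -> reach h k -> reach g k.
Proof. exact: rt_trans. Qed.

Lemma reach_sym g h : reach g h -> reach h g.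
Proof.
elim=> [x y [gx gy m]|x|x y z _ r1 _ r2]; last exact: rt_trans r2 r1.
  by apply: rt_step; split=> //; case: m; [right|left].
exact: rt_refl.
Qed.

Lemma reach_generating g h : reach g h -> generating_tuple g -> generating_tuple h.
Proof. by elim=> [x y [gx gy m]|x|x y z _ r1 _ r2] // /r1. Qed.

Lemma generating_tupleW g h : generating_tuple g ->
  (forall k, generated (range h) (g k)) -> generating_tuple h.
Proof.
move=> gg gh; apply/seteqP; split=> // x _; rewrite /generating_tuple in gg.
have : generated (range g) x by rewrite gg.
apply: generated_sub; first exact: generated_subgroup.
by move=> _ [k _ <-].
Qed.

Lemma set_entry_eq g i x : set_entry g i x i = x.
Proof. by rewrite ffunE eqxx. Qed.

Lemma set_entry_neq g i x k : k != i -> set_entry g i x k = g k.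
Proof. by rewrite ffunE => /negbTE ->. Qed.

Lemma set_entry_set_entry g i x y : set_entry (set_entry g i x) i y = set_entry g i y.
Proof. by apply/ffunP => k; rewrite !ffunE; case: eqP. Qed.

Lemma set_entry_id g i : set_entry g i (g i) = g.
Proof. by apply/ffunP => k; rewrite !ffunE; case: eqP => // ->. Qed.

(** An edge asks both ends to generate. Here [h] does, because the inverse move recovers the
    replaced entry of [g] from the entries of [h]. *)
Lemma reach_move g h : generating_tuple g -> nielsen_move g h -> reach g h.
Proof.
move=> gg m; apply: rt_step; split=> //; last by left.
apply: (generating_tupleW gg) => k.
have sH := generated_subgroup (range h).
have Hh l : generated (range h) (h l) by apply: sub_generated; exists l.
case: m sH Hh => [i j ji|i j ji|i j ji|i j ji|i] sH Hh;
  (have [->|ki] := eqVneq k i; last by [move: (Hh k); rewrite set_entry_neq]);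
  move: (Hh i); rewrite set_entry_eq => Hi;
  try (move: (Hh j); rewrite set_entry_neq // => Hj).
- by have := subgroupM sH Hi (subgroupV sH Hj); rewrite mulgK.
- by have := subgroupM sH Hi Hj; rewrite mulgVK.
- by have := subgroupM sH (subgroupV sH Hj) Hi; rewrite mulKg.
- by have := subgroupM sH Hj Hi; rewrite mulVKg.
- by have := subgroupV sH Hi; rewrite invgK.
Qed.

(** Phrasing the move on [set_entry g i x] lets successive moves at the same index compose without
    nested updates. *)
Lemma reach_mulr g i j x : j != i -> generating_tuple (set_entry g i x) ->
  reach (set_entry g i x) (set_entry g i (x * g j)).
Proof.
move=> ji /reach_move; apply.
have := Nielsen_mulr (set_entry g i x) ji.
by rewrite set_entry_set_entry set_entry_eq set_entry_neq.
Qed.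

Lemma reach_mulrV g i j x : j != i -> generating_tuple (set_entry g i x) ->
  reach (set_entry g i x) (set_entry g i (x * (g j)^-1)).
Proof.
move=> ji /reach_move; apply.
have := Nielsen_mulrV (set_entry g i x) ji.
by rewrite set_entry_set_entry set_entry_eq set_entry_neq.
Qed.

Lemma reach_mull g i j x : j != i -> generating_tuple (set_entry g i x) ->
  reach (set_entry g i x) (set_entry g i (g j * x)).
Proof.
move=> ji /reach_move; apply.
have := Nielsen_mull (set_entry g i x) ji.
by rewrite set_entry_set_entry set_entry_eq set_entry_neq.
Qed.

Lemma reach_mullV g i j x : j != i -> generating_tuple (set_entry g i x) ->
  reach (set_entry g i x) (set_entry g i ((g j)^-1 * x)).
Proof.
move=> ji /reach_move; apply.
have := Nielsen_mullV (set_entry g i x) ji.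
by rewrite set_entry_set_entry set_entry_eq set_entry_neq.
Qed.

End NielsenReach.

(** * Central modifications in class two *)

Section Center.
Variable G : groupType.
Implicit Types x y z : G.

Definition central z := forall y, commute z y.

Lemma central_subgroup : is_subgroup central.
Proof.
split=> [y|x y cx cy z|x cx y]; first exact/commute_sym/commute1.
  by apply/commute_sym/commuteM; apply/commute_sym.
by apply/commute_sym/commuteV/commute_sym.
Qed.

Lemma commgMl_central x y z : central [~ x, z] -> [~ x * y, z] = [~ x, z] * [~ y, z].
Proof.
move=> cxz; rewrite [RHS]cxz commgEl conjMg invgM.
by rewrite -mulgA (mulgA x^-1) -commgEl cxz mulgA -commgEl.
Qed.

Lemma commgMr_central (h u z : G) : central u -> [~ h * u, z] = [~ h, z].
Proof.
move=> cu; rewrite !commgEl conjMg invgM -!mulgA; apply: (canLR (mulKg _)).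
rewrite (_ : u ^ z = u); first by rewrite cu !mulgA.
by rewrite conjgE cu mulKg.
Qed.

End Center.

Section ClassTwo.
Variables (G : groupType) (n : nat) (x : {ffun 'I_n -> G}).
Hypothesis gx : generating_tuple x.
Hypothesis class2 : forall a b : G, central [~ a, b].
Implicit Types (g h : {ffun 'I_n -> G}) (a b u z : G).

Lemma commgMl a b z : [~ a * b, z] = [~ a, z] * [~ b, z].
Proof. exact: commgMl_central. Qed.

Lemma commgVl a z : [~ a^-1, z] = [~ a, z]^-1.
Proof. by apply/esym/mulg1_eq; rewrite -commgMl mulgV comm1g. Qed.

Lemma commg_subgroup (H : set G) z : is_subgroup H ->
  is_subgroup [set a | H [~ a, z]].
Proof.
move=> sH; split=> [|a b|a] /=.
- by rewrite comm1g; apply: subgroup1.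
- by rewrite commgMl; apply: subgroupM.
- by rewrite commgVl; apply: subgroupV.
Qed.

(** Bilinearity extends the hypothesis from generators one slot at a time; the second slot is
    reduced to the first by [[~ a, b]^-1 = [~ b, a]]. *)
Lemma commg_generated (H : set G) : is_subgroup H ->
  (forall j k, H [~ x j, x k]) -> forall a b, H [~ a, b].
Proof.
move=> sH Hx.
have gen (S : set G) : is_subgroup S -> (forall j, S (x j)) -> forall a, S a.
  move=> sS Sx a; have : generated (range x) a by rewrite gx.
  by apply: generated_sub => // _ [j _ <-].
have Hxk k a : H [~ a, x k].
  by apply: (gen _ (commg_subgroup (x k) sH)) => j; apply: Hx.
move=> a b; rewrite -invgR; apply: (subgroupV sH).
apply: (gen _ (commg_subgroup a sH)) => j /=.
by rewrite -invgR; apply: (subgroupV sH); apply: Hxk.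
Qed.

Definition central_shift h := forall k, central ((x k)^-1 * h k).

Lemma central_shiftR h j k : central_shift h -> [~ h j, h k] = [~ x j, x k].
Proof.
move=> hx; rewrite -(mulVKg (x j) (h j)) -(mulVKg (x k) (h k)).
have cR u a : central u -> [~ u, a] = 1 by move=> cu; apply/eqP/commgP.
rewrite commgMl (cR _ _ (hx j)) mulg1 -invgR commgMl (cR _ _ (hx k)) mulg1.
exact: invgR.
Qed.

(** The quantification over all [h] and [i] is what allows two shifts to be performed in
    succession. *)
Definition reach_shift z := forall h i, generating_tuple h -> central_shift h ->
  reach h (set_entry h i (h i * z)).

Lemma central_shift_entry h i z : central z -> central_shift h ->
  central_shift (set_entry h i (h i * z)).
Proof.
move=> cz hx k; have [->|ki] := eqVneq k i; last by rewrite set_entry_neq.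
by rewrite set_entry_eq mulgA; apply: (subgroupM (central_subgroup G)).
Qed.

(** Carrying [z^-1] along with [z] makes closure under inverses immediate. Centrality ensures that a
    shifted tuple is still a [central_shift], so that a second shift applies to it. *)
Lemma reach_shift_subgroup :
  is_subgroup [set z | [/\ central z, reach_shift z & reach_shift z^-1]].
Proof.
have sC := central_subgroup G.
have reachM u v : central u -> reach_shift u -> reach_shift v -> reach_shift (u * v).
  move=> cu ru rv h i gh hx; have r1 := ru h i gh hx.
  apply: (reach_trans r1).
  have := rv _ i (reach_generating r1 gh) (central_shift_entry i cu hx).
  by rewrite set_entry_set_entry set_entry_eq mulgA.
split=> [|u v [cu ru rVu] [cv rv rVv]|u [cu ru rVu]] /=.
- split; first exact: subgroup1 sC.
  + by move=> h i gh hx; rewrite mulg1 set_entry_id; apply: rt_refl.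
  + by move=> h i gh hx; rewrite invg1 mulg1 set_entry_id; apply: rt_refl.
- split; [exact: subgroupM sC _ _ _ _|exact: reachM|rewrite invgM; apply: reachM => //].
  exact: (subgroupV sC).
- by split; rewrite ?invgK //; apply: (subgroupV sC).
Qed.

(** Central factors do not affect commutators, so [[~ x j, x k]] may be replaced by [[~ h j, h k]],
    which is a word in the entries at hand. *)
Lemma reach_shift_commg_gen j k : reach_shift [~ x j, x k].
Proof.
move=> h i gh hx; rewrite -(central_shiftR j k hx).
have [<-|jk] := eqVneq j k; first by rewrite commgg mulg1 set_entry_id; apply: rt_refl.
have gh0 : generating_tuple (set_entry h i (h i)) by rewrite set_entry_id.
rewrite -[X in reach X](set_entry_id h i).
(* If [j = i], the new entry is the conjugate of [h i] by [h k]: two moves. *)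
have [ij|ij] := eqVneq j i.
  subst j; have ki : k != i by rewrite eq_sym.
  rewrite commgEl mulVKg conjgE.
  have r1 := reach_mulr ki gh0.
  exact: reach_trans r1 (reach_mullV ki (reach_generating r1 gh0)).
(* If [k = i], centrality of the commutator turns the new entry into the conjugate of [h i] by
   [(h j)^-1]. *)
have [ik|ik] := eqVneq k i.
  subst k.
  have -> : h i * [~ h j, h i] = h j * h i * (h j)^-1.
    apply: (canLR (mulVKg _)); rewrite mulgA; apply: (canRL (mulgK _)).
    by rewrite (class2 (h j) (h i) (h j)) commgEl conjgE !mulgA mulgV mul1g.
  have r1 := reach_mull jk gh0.
  exact: reach_trans r1 (reach_mulrV jk (reach_generating r1 gh0)).
(* Otherwise the four letters of the commutator are appended one by one. *)
rewrite commgEl conjgE !mulgA.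
have r1 := reach_mulrV ij gh0; have g1 := reach_generating r1 gh0.
have r2 := reach_mulrV ik g1; have g2 := reach_generating r2 g1.
have r3 := reach_mulr ij g2; have g3 := reach_generating r3 g2.
have r4 := reach_mulr ik g3.
exact: reach_trans (reach_trans r1 r2) (reach_trans r3 r4).
Qed.

Lemma reach_shift_gamma2 : gamma 2 `<=` [set z | central z /\ reach_shift z].
Proof.
move=> z /(sub_gammaSS reach_shift_subgroup) -[a b _|? ? ?//].
apply: (commg_generated reach_shift_subgroup) => j k /=; split=> //.
  exact: reach_shift_commg_gen.
by rewrite invgR; apply: reach_shift_commg_gen.
Qed.

Lemma reach_gamma2_shift h :
  (forall k, gamma 2 ((x k)^-1 * h k)) -> reach x h.
Proof.
move=> hx.
(* The tuples [t m] interpolate between [x] and [h]; passing from [t m] to [t m.+1] shifts a single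
   entry. *)
pose t m : {ffun 'I_n -> G} := [ffun k : 'I_n => if (k < m)%N then h k else x k].
have -> : h = t n by apply/ffunP => k; rewrite ffunE ltn_ord.
have tx m : central_shift (t m).
  move=> k; rewrite ffunE; case: ifP => _; first by case: (reach_shift_gamma2 (hx k)).
  by rewrite mulVg; apply: (subgroup1 (central_subgroup G)).
suff r m : (m <= n)%N -> reach x (t m) by apply: r.
elim: m => [_|m IHm mn].
  by have -> : t 0%N = x by [apply/ffunP => k; rewrite ffunE]; apply: rt_refl.
have r1 := IHm (ltnW mn); apply: (reach_trans r1).
have [_ /(_ (t m) (Ordinal mn) (reach_generating r1 gx) (tx m))] :=
  reach_shift_gamma2 (hx (Ordinal mn)).
congr (reach _ _); apply/ffunP => k.
have [->|km] := eqVneq k (Ordinal mn).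
  by rewrite set_entry_eq !ffunE /= ltnn ltnSn mulVKg.
rewrite set_entry_neq // !ffunE ltnS (leq_eqVlt k m).
by have /negbTE -> : (k != m :> nat)%N by exact: km.
Qed.

End ClassTwo.

(** * Reduction of exponent sums *)

Section Abelianization.
Variable G : groupType.

(** A type of its own, so that it can carry the additive structure in which integer multiples are
    written. *)
Definition abelianization : Type :=
  quotient_group (NormalSubgroup (gamma_normal G 2)).

Definition abel (x : G) : abelianization := coset _ x.

HB.instance Definition _ := Choice.on abelianization.

Let aadd (a b : abelianization) : abelianization := a * b.
Let aopp (a : abelianization) : abelianization := a^-1.

Let aaddC : commutative aadd.
Proof.
move=> a b; have [x ->] := coset_surj a; have [y ->] := coset_surj b.
rewrite /aadd -!cosetM; apply/cosetP; rewrite invgM -mulgA -conjgE -commgEl.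
exact: gammaR.
Qed.

HB.instance Definition _ := GRing.isZmodule.Build abelianization
  (@mulgA _) aaddC (@mul1g _) (@mulVg _).

Lemma abelM x y : abel (x * y) = (abel x + abel y)%R.
Proof. exact: cosetM. Qed.

Lemma abelV x : abel x^-1 = (- abel x)%R.
Proof. exact: cosetV. Qed.

Lemma abel_eq0 x : abel x = 0%R -> gamma 2 x.
Proof. by move=> /esym/cosetP; rewrite invg1 mul1g. Qed.

End Abelianization.

Section ExponentSums.
Variables (G : groupType) (n : nat) (x : {ffun 'I_n -> G}) (e : 'I_n -> G -> int).
Hypothesis gx : generating_tuple x.
Hypothesis eM : forall k, {morph e k : a b / a * b >-> (a + b)%R}.
Hypothesis ex : forall k i, e k (x i) = (i == k)%:R%R.

Lemma expsum1 k : e k 1 = 0%R.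
Proof. by apply: (addrI (e k 1)); rewrite -eM mulg1 addr0. Qed.

Lemma expsumV k a : e k a^-1 = (- e k a)%R.
Proof. by apply: (addrI (e k a)); rewrite -eM mulgV subrr expsum1. Qed.

(** Modulo [gamma 2], every [a] is the sum of the [x k] with multiplicities [e k a]: both sides are
    additive in [a] and agree on the generators. *)
Lemma expsum0_gamma2 a : (forall k, e k a = 0%R) -> gamma 2 a.
Proof.
move=> ea0; apply: abel_eq0.
suff -> : abel a = (\sum_k abel (x k) *~ e k a)%R.
  by rewrite big1 // => k _; rewrite ea0 mulr0z.
pose S := [set a | abel a = (\sum_k abel (x k) *~ e k a)%R].
have: generated (range x) a by rewrite gx.
apply: (@generated_sub _ _ S) => [|_ [i _ <-]]; last first.
  rewrite /S /= (bigD1 i) //= ex eqxx mulr1z big1 ?addr0 // => k ki.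
  by rewrite ex eq_sym (negbTE ki) mulr0z.
split=> [|b c|b]; rewrite /S /=.
- by rewrite big1 // => k _; rewrite expsum1 mulr0z.
- by rewrite abelM => -> ->; rewrite -big_split; apply: eq_bigr => k _; rewrite eM mulrzDr.
- by rewrite abelV => ->; rewrite -sumrN; apply: eq_bigr => k _; rewrite expsumV mulrNz.
Qed.

Implicit Types g h : {ffun 'I_n -> G}.

Definition reduced_below (m : nat) g :=
  forall i j : 'I_n, (j < m)%N -> e j (g i) = (i == j)%:R%R.

(** The rows [(e j (g i))_j] of a generating tuple span the integer lattice, so each unit vector is
    an integral combination of them. *)
Lemma generating_combination g (k : 'I_n) : generating_tuple g ->
  exists L : 'I_n -> int, forall j, (\sum_i L i * e j (g i))%R = (k == j)%:R%R.
Proof.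
move=> gg; pose S := [set a | exists L : 'I_n -> int,
  forall j, (\sum_i L i * e j (g i))%R = e j a].
suff [L HL] : S (x k) by exists L => j; rewrite HL ex.
have: generated (range g) (x k) by rewrite gg.
apply: generated_sub => [|_ [i _ <-]]; last first.
  exists (fun l => (l == i)%:R%R) => j; rewrite (bigD1 i) //= eqxx mul1r.
  by rewrite big1 ?addr0 // => l /negbTE ->; rewrite mul0r.
split=> [|a b [L HL] [M HM]|a [L HL]].
- by exists (fun _ => 0%R) => j; rewrite expsum1 big1 // => i _; rewrite mul0r.
- exists (fun i => L i + M i)%R => j; rewrite eM -HL -HM -big_split.
  by apply: eq_bigr => i _; rewrite mulrDl.
- exists (fun i => - L i)%R => j; rewrite expsumV -HL -sumrN.
  by apply: eq_bigr => i _; rewrite mulNr.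
Qed.

Lemma reach_addrow g (i j : 'I_n) (s : bool) : j != i -> generating_tuple g ->
  exists2 y, reach g (set_entry g i y) &
    forall k, e k y = (e k (g i) + (-1) ^+ s * e k (g j))%R.
Proof.
move=> ji gg; have gg0 : generating_tuple (set_entry g i (g i)) by rewrite set_entry_id.
rewrite -[X in reach X](set_entry_id g i); case: s.
  exists (g i * (g j)^-1); first exact: reach_mulrV.
  by move=> k; rewrite eM expsumV expr1 mulN1r.
exists (g i * g j); first exact: reach_mulr.
by move=> k; rewrite eM expr0 mul1r.
Qed.

(** A row of index at least [m] vanishes in the first [m] columns, so adding it to another row
    leaves them unchanged. *)
Lemma reduced_below_set_entry m g (i j : 'I_n) y s :
    reduced_below m g -> (m <= j)%N ->
    (forall k, e k y = (e k (g i) + (-1) ^+ s * e k (g j))%R) ->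
  reduced_below m (set_entry g i y).
Proof.
move=> rg mj ey l k km; rewrite ffunE; case: eqP => [->|_]; last exact: rg.
rewrite ey !rg //; suff /negbTE -> : j != k by rewrite mulr0 addr0.
by apply: contraTneq mj => ->; rewrite -ltnNge.
Qed.

Definition column_size (k : 'I_n) g := (\sum_i `|e k (g i)|)%N.

(** Euclid's algorithm on column [k], by induction on the sum of absolute values. Only rows of index
    at least [k] are added to others, which protects the earlier columns. *)
Lemma reach_pivot (k : 'I_n) g : generating_tuple g -> reduced_below k g ->
  exists h, [/\ reach g h, reduced_below k h &
    exists j : 'I_n, [/\ (k <= j)%N, `|e k (h j)|%N = 1%N &
      forall i, i != j -> e k (h i) = 0%R]].
Proof.
have [N] := ubnP (column_size k g); elim: N g => // N IHN g sz gg rg.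
have [[j [i [kj ij j0 le]]]|min] := pselect (exists j i : 'I_n,
   [/\ (k <= j)%N, i != j, e k (g j) != 0%R & (`|e k (g j)| <= `|e k (g i)|)%N]).
  (* Subtract when the signs agree and add when they differ, so that the absolute value in row [i]
     drops. *)
  pose s := ((0 <= e k (g j)) == (0 <= e k (g i)))%R.
  have ji : j != i by rewrite eq_sym.
  have [y r1 ey] := reach_addrow s ji gg.
  have rg1 := reduced_below_set_entry rg kj ey.
  have sz1 : (column_size k (set_entry g i y) < N)%N.
    rewrite ltnS in sz; apply: leq_trans sz; rewrite /column_size (bigD1 i) //= [X in (_ < X)%N](bigD1 i) //=.
    rewrite set_entry_eq ey.
    under eq_bigr => l li do rewrite set_entry_neq //.
    rewrite ltn_add2r /s; move: j0 le; case: (e k (g j)) (e k (g i)) => [a|a] [b|b] /=; lia.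
  have [h [r2 rh pvt]] := IHN _ sz1 (reach_generating r1 gg) rg1.
  by exists h; split=> //; apply: reach_trans r1 r2.
exists g; split=> //; first exact: rt_refl.
(* No reduction is possible any more. In the combination giving the [k]-th unit vector, the earlier
   columns force the coefficients of rows before [k] to vanish, so some row from [k] on is nonzero
   in column [k]. *)
have [L HL] := generating_combination k gg.
have L0 (i : 'I_n) : (i < k)%N -> L i = 0%R.
  move=> ik; have := HL i; rewrite (bigD1 i) //= rg // eqxx mulr1 big1.
    rewrite addr0 => ->; suff /negbTE -> : k != i by [].
    by apply: contraTneq ik => ->; rewrite ltnn.
  by move=> l /negbTE li; rewrite rg // li mulr0.
have Lk := HL k; rewrite eqxx in Lk.
have [j Lj] : exists j, (L j * e k (g j) != 0)%R.
  apply/not_existsP => Z; move: Lk; rewrite big1 // => i _.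
  by apply/eqP/negPn/negP/Z.
have kj : (k <= j)%N.
  by rewrite leqNgt; apply: contra Lj => /L0 ->; rewrite mul0r.
have j0 : e k (g j) != 0%R by apply: contra Lj => /eqP ->; rewrite mulr0.
have lt i : i != j -> (`|e k (g i)| < `|e k (g j)|)%N.
  by move=> ij; rewrite ltnNge; apply/negP => le; apply: min; exists j, i.
(* A second nonzero entry from row [k] on, being smaller, could be used to reduce row [j]. *)
have i0 i : i != j -> (k <= i)%N -> e k (g i) = 0%R.
  move=> ij ki; apply/eqP/negPn/negP => nz; apply: min; exists i, j.
  by rewrite eq_sym ij (ltnW (lt _ ij)).
have ej1 : `|e k (g j)|%N = 1%N.
  move: Lk; rewrite (bigD1 j) //= big1 => [|i ij].
    rewrite addr0 => /(congr1 absz); rewrite abszM => /eqP; rewrite muln_eq1.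
    by case/andP => _ /eqP.
  by have [/L0 ->|/(i0 _ ij) ->] := ltnP i k; rewrite ?mul0r ?mulr0.
(* The remaining entries, those in rows before [k] included, are smaller than 1 in absolute
   value. *)
exists j; split=> // i ij; have := lt i ij; rewrite ej1; lia.
Qed.

Lemma reach_next_column (k : 'I_n) g : generating_tuple g -> reduced_below k g ->
  exists2 h, reach g h & reduced_below k.+1 h.
Proof.
move=> gg rg.
have [h [r1 rh [j [kj ej eh]]]] := reach_pivot gg rg.
have {r1 kj ej eh} [h' [r2 rh' ek eh]] : exists h', [/\ reach g h', reduced_below k h',
    `|e k (h' k)|%N = 1%N & forall i, i != k -> e k (h' i) = 0%R].
  have [jk|jk] := eqVneq j k; first by subst j; exists h; split.
  have gh := reach_generating r1 gg.
  (* Adding row [j] to row [k], then subtracting row [k] from row [j], carries the pivot to row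
     [k]. *)
  have [y r2 ey] := reach_addrow false jk gh.
  have kj' : k != j by rewrite eq_sym.
  have [z r3 ez] := reach_addrow true kj' (reach_generating r2 gh).
  exists (set_entry (set_entry h k y) j z).
  split; [exact: reach_trans r1 (reach_trans r2 r3) | | |].
  - apply: (reduced_below_set_entry _ (leqnn k) ez).
    exact: (reduced_below_set_entry rh kj ey).
  - by rewrite set_entry_neq // set_entry_eq ey eh // add0r expr0 mul1r.
  - move=> i ik; have [->|ij] := eqVneq i j; last by rewrite !set_entry_neq // eh.
    rewrite set_entry_eq ez set_entry_eq set_entry_neq // ey (eh k) // add0r.
    by rewrite expr0 expr1 mul1r mulN1r subrr.
(* A pivot equal to -1 is corrected by inverting entry [k], whose earlier columns are zero. *)
have [h2 [r3 rh2 ek2 eh2]] : exists h2, [/\ reach g h2, reduced_below k h2,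
    e k (h2 k) = 1%R & forall i, i != k -> e k (h2 i) = 0%R].
  have [ek1|ek1] := eqVneq (e k (h' k)) 1%R; first by exists h'.
  have gh' := reach_generating r2 gg.
  exists (set_entry h' k (h' k)^-1); split.
  - by apply: (reach_trans r2); apply: reach_move gh' _; apply: Nielsen_inv.
  - move=> i l lk; rewrite ffunE; case: eqP => [->|_]; last exact: rh'.
    rewrite expsumV rh' //; suff /negbTE -> : k != l by rewrite oppr0.
    by apply: contraTneq lk => ->; rewrite ltnn.
  - rewrite set_entry_eq expsumV; lia.
  - by move=> i ik; rewrite set_entry_neq // eh.
exists h2 => // i l; rewrite ltnS leq_eqVlt => /predU1P[/val_inj ->|]; last exact: rh2.
by have [->|/eh2] := eqVneq i k.
Qed.

Lemma reach_reduced g : generating_tuple g -> exists2 h, reach g h & reduced_below n h.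
Proof.
move=> gg; suff H m : (m <= n)%N -> exists2 h, reach g h & reduced_below m h by apply: H.
elim: m => [_|m IHm mn]; first by exists g => //; apply: rt_refl.
have [h r1 rh] := IHm (ltnW mn).
have [h' r2 rh'] := @reach_next_column (Ordinal mn) h (reach_generating r1 gg) rh.
by exists h' => //; apply: reach_trans r1 r2.
Qed.

Hypothesis class2 : forall a b : G, central [~ a, b].

Lemma class2_connected : nielsen_graph_connected n G.
Proof.
have to_x g : generating_tuple g -> reach x g.
  move=> /reach_reduced [h r1 rh]; apply: reach_trans (reach_sym r1).
  apply: reach_gamma2_shift => // k; apply: expsum0_gamma2 => j.
  by rewrite eM expsumV ex rh // addNr.
move=> g h /to_x rg /to_x rh; exact: reach_trans (reach_sym rg) rh.
Qed.

End ExponentSums.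

(** * Connectedness for classes one and two *)

Lemma free_nilpotent_commutator_eq1 n c (a b d : free_nilpotent n c.+1) : (c <= 1)%N ->
  [~ d, [~ a, b]] = 1.
Proof.
move=> c1; have [y ->] := coset_surj a; have [z ->] := coset_surj b; have [w ->] := coset_surj d.
set N := NormalSubgroup _.
transitivity (coset N [~ w, [~ y, z]]); first by rewrite !cosetR.
apply/esym/cosetP; rewrite invg1 mul1g; apply: gammaR.
case: c c1 @N {a b d} => [|[|//]] _ _; first exact: I.
by apply: gammaR; apply: I.
Qed.

Lemma free_nilpotent_connected n c : (c <= 1)%N ->
  nielsen_graph_connected n (free_nilpotent n c.+1).
Proof.
move=> c1.
(* The exponent sum of the [k]-th generator, valued in the integers written multiplicatively;
   commutativity makes it kill [gamma c.+2]. *)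
pose e0 (k : 'I_n) := @free_hom 'I_n (GRing.to_multiplicative int)
  (fun i : 'I_n => (i == k)%:R%R : int).
pose e k (a : free_nilpotent n c.+1) : int := quotient_hom (e0 k) a.
have e0N k (y : freegroup 'I_n) : gamma c.+2 y -> e0 k y = 1.
  move: y; apply: sub_gammaSS => [|y z _].
    apply: (@morph_subgroup_preim _ _ (e0 k) [set 1]).
    by split=> //= [y z -> ->|y ->]; rewrite ?mulg1 ?invg1.
  by rewrite /= /e0 gmulfR; apply/eqP/commgP/GRing.commuteT.
apply: (@class2_connected _ _ (free_nilpotent_basis n c.+1) e).
- exact: free_nilpotent_basisP.
- move=> k a b; exact: (@quotient_homM _ (NormalSubgroup _) _ (free_hom _) (e0N k) a b).
- by move=> k i; rewrite /e ffunE (@quotient_hom_coset _ (NormalSubgroup _) _ (free_hom _) (e0N k)) /= free_hom_gen.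
- by move=> a b d; apply/commute_sym/commgP/eqP/free_nilpotent_commutator_eq1.
Qed.

(** * The determinant of Fox derivatives *)

Section TruncatedPolynomials.
Local Open Scope ring_scope.

(* [Trunc a b c] is the class of [a + b t + c t^2] in [Z[t]/(t^3)]. *)
Record trunc := Trunc { tc0 : int; tc1 : int; tc2 : int }.

Let to_triple (p : trunc) := (tc0 p, tc1 p, tc2 p).
Let of_triple (p : int * int * int) := Trunc p.1.1 p.1.2 p.2.
Let triple_can : cancel to_triple of_triple. Proof. by case. Qed.

HB.instance Definition _ := Choice.copy trunc (can_type triple_can).

Let tadd p q := Trunc (tc0 p + tc0 q) (tc1 p + tc1 q) (tc2 p + tc2 q).
Let topp p := Trunc (- tc0 p) (- tc1 p) (- tc2 p).
Let tmul p q := Trunc (tc0 p * tc0 q) (tc0 p * tc1 q + tc1 p * tc0 q)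
  (tc0 p * tc2 q + tc1 p * tc1 q + tc2 p * tc0 q).

Let taddA : associative tadd.
Proof. by move=> p q r; rewrite /tadd /= !addrA. Qed.
Let taddC : commutative tadd.
Proof. by move=> p q; congr Trunc; apply: addrC. Qed.
Let tadd0 : left_id (Trunc 0 0 0) tadd.
Proof. by case=> *; rewrite /tadd /= !add0r. Qed.
Let taddN : left_inverse (Trunc 0 0 0) topp tadd.
Proof. by case=> *; rewrite /tadd /= !addNr. Qed.

HB.instance Definition _ := GRing.isZmodule.Build trunc taddA taddC tadd0 taddN.

Let tmulA : associative tmul.
Proof. by move=> p q r; congr Trunc => /=; ring. Qed.
Let tmulC : commutative tmul.
Proof. by move=> p q; congr Trunc => /=; ring. Qed.
Let tmul1 : left_id (Trunc 1 0 0) tmul.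
Proof. by case=> *; rewrite /tmul /= !mul1r !mul0r !addr0. Qed.
Let tmulD : left_distributive tmul +%R.
Proof. by move=> p q r; congr Trunc => /=; ring. Qed.
Let tmul0 : Trunc 1 0 0 != 0.
Proof. by []. Qed.

HB.instance Definition _ :=
  GRing.Zmodule_isComNzRing.Build trunc tmulA tmulC tmul1 tmulD tmul0.

Definition tvar : trunc := Trunc 0 1 0.

(* The class of exp (2 k t); the factor 2 keeps the coefficients integral. *)
Definition texp (k : int) : trunc := Trunc 1 (k *+ 2) (k ^+ 2 *+ 2).

Lemma trunc1E : 1 = Trunc 1 0 0.
Proof. by []. Qed.

Lemma truncD a b c a' b' c' :
  Trunc a b c + Trunc a' b' c' = Trunc (a + a') (b + b') (c + c').
Proof. by []. Qed.

Lemma truncN a b c : - Trunc a b c = Trunc (- a) (- b) (- c).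
Proof. by []. Qed.

Lemma truncM a b c a' b' c' : Trunc a b c * Trunc a' b' c' =
  Trunc (a * a') (a * b' + b * a') (a * c' + b * b' + c * a').
Proof. by []. Qed.

Lemma texp0 : texp 0 = 1.
Proof. by []. Qed.

Lemma texpD k l : texp (k + l) = texp k * texp l.
Proof. by rewrite /texp truncM; congr Trunc; ring. Qed.

Lemma texpNK k : texp (- k) * texp k = 1.
Proof. by rewrite -texpD addNr. Qed.

Lemma texp_sub1 k : exists w, texp k - 1 = tvar * w.
Proof.
exists (Trunc (k *+ 2) (k ^+ 2 *+ 2) 0).
by rewrite /texp /tvar trunc1E truncN truncD truncM; congr Trunc; ring.
Qed.

Lemma tvar3 : tvar ^+ 3 = 0.
Proof. by []. Qed.

End TruncatedPolynomials.

Section AffineGroup.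
Variable n : nat.

(** The semidirect product of the integers with R^n, where [k] acts as [texp k]. The second
    component of a homomorphism into it is a crossed homomorphism. *)
Definition affine : Type := (int * 'rV[trunc]_n)%type.
HB.instance Definition _ := Choice.on affine.
Implicit Types a b : affine.

Let amul a b : affine := (a.1 + b.1, a.2 + texp a.1 *: b.2)%R.
Let ainv a : affine := (- a.1, - (texp (- a.1) *: a.2))%R.

Let amulA : associative amul.
Proof.
by move=> a b c; rewrite /amul /= addrA scalerDr scalerA -texpD addrA.
Qed.
Let amul1g : left_id (0, 0)%R amul.
Proof. by case=> k u; rewrite /amul /= !add0r texp0 scale1r. Qed.
Let amulg1 : right_id (0, 0)%R amul.
Proof. by case=> k u; rewrite /amul /= scaler0 !addr0. Qed.
Let amulVg : left_inverse (0, 0)%R ainv amul.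
Proof. by case=> k u; rewrite /amul /= !addNr. Qed.
Let amulgV : right_inverse (0, 0)%R ainv amul.
Proof.
case=> k u; rewrite /amul /= subrr scalerN scalerA -texpD subrr texp0 scale1r.
by rewrite subrr.
Qed.

HB.instance Definition _ :=
  isGroup.Build affine amulA amul1g amulg1 amulVg amulgV.

Lemma affineM a b : a * b = (a.1 + b.1, a.2 + texp a.1 *: b.2)%R.
Proof. by []. Qed.

Lemma affineV a : a^-1 = (- a.1, - (texp (- a.1) *: a.2))%R.
Proof. by []. Qed.

Lemma affine_commg a b : [~ a, b] =
  (0, texp (- (a.1 + b.1)) *:
        ((1 - texp b.1) *: a.2 - (1 - texp a.1) *: b.2))%R.
Proof.
rewrite commgEl conjgE mulgA -invgM affineM affineV /=; congr pair; first by ring.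
rewrite [(b.1 + a.1)%R]addrC [LHS]addrC -scalerBr; congr (_ *: _)%R.
rewrite !scalerBl !scale1r !opprB opprD -!addrA; congr (_ + _)%R.
by rewrite [RHS]addrC -addrA.
Qed.

(** The translations by t^i R^n. Each [texp k] is 1 modulo t, so a commutator with any element goes
    one level deeper, and level 3 is trivial. *)
Definition affine_level i : set affine :=
  [set a | a.1 = 0%R /\ exists v, a.2 = (tvar ^+ i *: v)%R].

Lemma affine_level_subgroup i : is_subgroup (affine_level i).
Proof.
split=> [|a b [a1 [u au]] [b1 [v bv]]|a [a1 [u au]]].
- by split=> //; exists 0%R; rewrite scaler0.
- split; rewrite affineM /= a1 ?b1 ?addr0 //; exists (u + v)%R.
  by rewrite au bv texp0 scale1r scalerDr.
- split; rewrite affineV /= a1 ?oppr0 //; exists (- u)%R.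
  by rewrite au texp0 scale1r scalerN.
Qed.

Lemma affine_levelR i a b : affine_level i b -> affine_level i.+1 [~ a, b].
Proof.
case=> b1 [v bv]; rewrite affine_commg; split=> //=.
have [w aw] := texp_sub1 a.1.
rewrite b1 addr0 texp0 subrr scale0r sub0r -scaleNr opprB aw bv !scalerA.
by exists (texp (- a.1) * w *: v)%R; rewrite scalerA exprS; congr (_ *: _)%R; ring.
Qed.

(** The start of the filtration argument needs its own proof: a general element has a nonzero
    integer part and so lies in no level. *)
Lemma affine_level1R a b : affine_level 1 [~ a, b].
Proof.
rewrite affine_commg; split=> //=.
have [w aw] := texp_sub1 a.1; have [w' bw] := texp_sub1 b.1.
rewrite -(opprB (texp a.1)) -(opprB (texp b.1)) aw bw.
exists (texp (- (a.1 + b.1)) *: (- w' *: a.2 + w *: b.2))%R.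
rewrite !(scalerDr, scalerA, scalerN, scaleNr, opprK, mulrN, mulNr) expr1.
by congr (- (_ *: _) + _ *: _)%R; ring.
Qed.

Lemma affine_level3 i a : (2 < i)%N -> affine_level i a -> a = 1.
Proof.
case: a => k u /= i3 [/= -> [v ->]].
by rewrite -(subnK i3) exprD tvar3 mulr0 scale0r.
Qed.

End AffineGroup.

(** * Nielsen moves change the determinant by trivial units *)

Section DeterminantInvariant.
Variable n : nat.

(** The images of the units [+/- u^k] of the Laurent polynomial ring Z[u, 1/u] under the map sending
    u to [texp 1]. *)
Definition trivial_unit (d : trunc) := exists (s : bool) k, d = ((-1) ^+ s * texp k)%R.

Lemma trivial_unitM d d' : trivial_unit d -> trivial_unit d' -> trivial_unit (d * d')%R.
Proof.
move=> [s [k ->]] [s' [k' ->]]; exists (s (+) s'), (k + k')%R.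
by rewrite signr_addb texpD; ring.
Qed.

Lemma trivial_unitV d : trivial_unit d -> exists2 d', trivial_unit d' & (d' * d)%R = 1%R.
Proof.
move=> [s [k ->]]; exists ((-1) ^+ s * texp (- k))%R; first by exists s, (- k)%R.
by rewrite mulrACA -signr_addb addbb texpNK mulr1.
Qed.

Lemma trivial_unitMl d d' : trivial_unit d -> trivial_unit (d * d')%R -> trivial_unit d'.
Proof.
move=> /trivial_unitV [e ue ed] udd'.
by rewrite -[d']mul1r -ed -mulrA; apply: trivial_unitM.
Qed.

Definition rows_mx (u : 'I_n -> 'rV[trunc]_n) : 'M[trunc]_n := \matrix_(i, j) u i 0%R j.

Definition det_rows u := (\det (rows_mx u))%R.

Lemma det_rows_update (u u' : 'I_n -> 'rV[trunc]_n) i j a b : j != i ->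
  u' i = (a *: u i + b *: u j)%R -> (forall k, k != i -> u' k = u k) ->
  det_rows u' = (a * det_rows u)%R.
Proof.
move=> ji ui uk.
(* By linearity in row [i], the term with coefficient [b] is the determinant of [v], whose rows [i]
   and [j] coincide. *)
pose v k := if k == i then u j else u k.
have row'E (w : 'I_n -> 'rV[trunc]_n) :
    (forall k, k != i -> w k = u' k) -> row' i (rows_mx w) = row' i (rows_mx u').
  by move=> wk; apply/matrixP => k l; rewrite !mxE wk // eq_sym neq_lift.
rewrite /det_rows (@determinant_multilinear _ _ _ (rows_mx u) (rows_mx v) i a b).
- rewrite [(\det (rows_mx v))%R](@determinant_alternate _ _ _ i j).
  + by rewrite mulr0 addr0.
  + by rewrite eq_sym.
  + by move=> l; rewrite !mxE /v eqxx (negbTE ji).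
- by apply/matrixP => k l; rewrite !mxE ui !mxE /v eqxx.
- by apply: row'E => k ki; rewrite uk.
- by apply: row'E => k ki; rewrite /v (negbTE ki) uk.
Qed.

Lemma det_rows_scale (u u' : 'I_n -> 'rV[trunc]_n) i a :
  u' i = (a *: u i)%R -> (forall k, k != i -> u' k = u k) ->
  det_rows u' = (a * det_rows u)%R.
Proof.
move=> ui uk.
have row'E : row' i (rows_mx u) = row' i (rows_mx u').
  by apply/matrixP => k l; rewrite !mxE uk // eq_sym neq_lift.
rewrite /det_rows (@determinant_multilinear _ _ _ (rows_mx u) (rows_mx u) i a 0%R) //.
  by rewrite mul0r addr0.
by apply/matrixP => k l; rewrite !mxE ui !mxE mul0r addr0.
Qed.

Variables (G : groupType) (f : G -> affine n).
Hypothesis fM : {morph f : x y / x * y}.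
Implicit Types g h : {ffun 'I_n -> G}.

Definition fox_det g := det_rows (fun i => (f (g i)).2).

(** By the crossed product rule, right multiplication adds a multiple of row [j] to row [i]; left
    multiplication also scales row [i] by a power of [texp 1], and inversion scales it by minus such
    a power. *)
Lemma fox_det_move g h : nielsen_move g h ->
  exists2 d, trivial_unit d & fox_det h = (d * fox_det g)%R.
Proof.
have f1 : f 1 = 1 by apply: (mulgI (f 1)); rewrite -fM !mulg1.
have fV x : f x^-1 = (f x)^-1 by apply/esym/mulg1_eq; rewrite -fM mulgV.
have tu k : trivial_unit (texp k) by exists false, k; rewrite mul1r.
have other i y k : k != i -> (f (set_entry g i y k)).2 = (f (g k)).2.
  by move=> ki; rewrite set_entry_neq.
case=> [i j ji|i j ji|i j ji|i j ji|i].
- exists (texp 0) => //.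
  apply: (det_rows_update ji _ (other i _)).
  by rewrite set_entry_eq fM affineM /= texp0 scale1r.
- exists (texp 0) => //.
  apply: (det_rows_update (b := - (texp (f (g i)).1 * texp (- (f (g j)).1))%R) ji _ (other i _)).
  by rewrite set_entry_eq fM fV affineM affineV /= texp0 scale1r scalerN scaleNr scalerA.
- exists (texp (f (g j)).1) => //.
  apply: (det_rows_update (b := 1%R) ji _ (other i _)).
  by rewrite set_entry_eq fM affineM /= scale1r addrC.
- exists (texp (- (f (g j)).1)) => //.
  apply: (det_rows_update (b := - texp (- (f (g j)).1)%R) ji _ (other i _)).
  by rewrite set_entry_eq fM fV affineM affineV /= scaleNr addrC.
- exists (- texp (- (f (g i)).1))%R; first by exists true, (- (f (g i)).1)%R; rewrite mulN1r.
  apply: (det_rows_scale _ (other i _)).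
  by rewrite set_entry_eq fV affineV /= scaleNr.
Qed.

Lemma fox_det_reach g h : reach g h ->
  trivial_unit (fox_det g) <-> trivial_unit (fox_det h).
Proof.
elim=> [x y [_ _ m]|x|x y z _ IH1 _ IH2] //; last by rewrite IH1.
case: m => /fox_det_move [d ud ->]; split.
- exact: trivial_unitM.
- exact: trivial_unitMl.
- exact: trivial_unitMl.
- exact: trivial_unitM.
Qed.

End DeterminantInvariant.

(** * A generating tuple that Nielsen moves cannot reach from the basis *)

Section NilpotentGeneration.
Variables (G : groupType) (n : nat) (x : {ffun 'I_n -> G}) (i0 i1 : 'I_n).

Definition nontame_tuple : {ffun 'I_n -> G} :=
  set_entry x i0 (x i0 * [~ [~ x i0, x i1], x i1]).

(** Successive approximation: [x i0] agrees with some element of [H] modulo each term of the lower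
    central series, the last of which is trivial. *)
Lemma nontame_tuple_generating m : i1 != i0 -> gamma m.+1 `<=` [set (1 : G)] ->
  generating_tuple x -> generating_tuple nontame_tuple.
Proof.
move=> i10 Gm gx; set H := generated (range nontame_tuple).
have sH : is_subgroup H by apply: generated_subgroup.
have Hy k : H (nontame_tuple k) by apply: sub_generated; exists k.
have Hx k : k != i0 -> H (x k) by move=> ki; have := Hy k; rewrite set_entry_neq.
have HR a b : H a -> H b -> H [~ a, b].
  move=> Ha Hb; rewrite commgEl conjgE.
  by do !apply: (subgroupM sH) => //; apply: (subgroupV sH).
have approx i : exists2 h, H h & gamma i.+1 (h^-1 * x i0).
  elim: i => [|i [h Hh Gh]]; first by exists 1; [apply: subgroup1 sH|].
  (* If [h] approximates [x i0] modulo [gamma i.+1], the error is central modulo [gamma i.+2], so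
     the double commutator may be computed there with [h] and divided out inside [H]. *)
  exists (nontame_tuple i0 * [~ [~ h, x i1], x i1]^-1).
    by apply: (subgroupM sH) => //; apply: (subgroupV sH); apply: (HR) (Hx _ i10); apply: (HR) (Hx _ i10).
  pose N := NormalSubgroup (gamma_normal G i.+2).
  have cu : central (coset N (h^-1 * x i0)).
    move=> b; have [y ->] := coset_surj b; apply/commute_sym/commgP/eqP.
    by rewrite -cosetR; apply/esym/cosetP; rewrite invg1 mul1g; apply: gammaR.
  have x0E : coset N (x i0) = coset N h * coset N (h^-1 * x i0).
    by rewrite -cosetM mulVKg.
  have zE : coset N [~ [~ x i0, x i1], x i1] = coset N [~ [~ h, x i1], x i1].
    by rewrite !cosetR x0E (commgMr_central _ _ cu).
  apply/(@cosetP _ N); rewrite set_entry_eq (cosetM _ (x i0 * _)) (cosetM _ (x i0)).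
  by rewrite cosetV zE mulgK.
apply: (generating_tupleW gx) => k; have [->|] := eqVneq k i0; last exact: Hx.
by have [h Hh /Gm /= /mulg1_eq] := approx m; rewrite invgK => <-.
Qed.

End NilpotentGeneration.

Lemma gamma_surj (G A : groupType) (f : UMagmaMorphism.type G A) i :
  (forall a, exists x, a = f x) -> gamma i.+1 `<=` f @` gamma i.+1.
Proof.
move=> fs; elim: i => [|i IHi]; first by move=> a _; have [y ->] := fs a; exists y.
have sG := normal_subgroup (gamma_normal G i.+2).
apply: sub_gammaSS => [|a b /IHi [z Gz <-]].
  split=> [|_ _ [y Gy <-] [z Gz <-]|_ [y Gy <-]].
  - by exists 1; [exact: subgroup1 sG|exact: gmulf1].
  - by exists (y * z); [exact: subgroupM sG _ _ Gy Gz|exact: gmulfM].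
  - by exists y^-1; [exact: subgroupV sG _ Gy|exact: gmulfV].
by have [y ->] := fs a; exists [~ y, z]; [apply: gammaR|apply: gmulfR].
Qed.

Lemma free_nilpotent_gamma n c : gamma c.+1 `<=` [set (1 : free_nilpotent n c)].
Proof.
move=> a /(gamma_surj (@coset_surj _ _)) [y Gy <-] /=.
by apply/esym/cosetP; rewrite invg1 mul1g.
Qed.

(** The constant term forces the sign +, the coefficient of t forces [k = 0], and then the
    coefficient of t^2 would be 0. *)
Lemma texp4_not_trivial_unit : ~ trivial_unit (Trunc 1 0 4).
Proof.
case=> -[] [k]; rewrite ?expr1 ?expr0 ?mulN1r ?mul1r /texp ?truncN => -[] //; lia.
Qed.

Lemma free_nilpotent_not_connected n c : (1 < n)%N -> (2 < c)%N ->
  ~ nielsen_graph_connected n (free_nilpotent n c).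
Proof.
move=> n1 c2 conn.
pose i0 : 'I_n := Ordinal (ltnW n1); pose i1 : 'I_n := Ordinal n1.
have i10 : i1 != i0 by [].
(* Only the generator [i1] acts nontrivially; the translation parts are the standard basis
   vectors. *)
pose phi i : affine n := ((i == i1)%:R, delta_mx 0 i)%R.
pose f0 := free_hom phi.
have sf0 j : is_subgroup (f0 @^-1` affine_level j).
  exact: morph_subgroup_preim (affine_level_subgroup _ _).
have f0N i y : gamma i.+2 y -> affine_level i.+1 (f0 y).
  elim: i y => [|i IHi]; apply: (sub_gammaSS (sf0 _)) => y z Gz; rewrite /= /f0 gmulfR.
    exact: affine_level1R.
  by apply: affine_levelR; apply: IHi.
pose N := NormalSubgroup (gamma_normal (freegroup 'I_n) c.+1).
have fN y : N y -> f0 y = 1.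
  (* [gamma c.+1] lands in level [c], which is trivial as [c] is at least 3. *)
  by case: (c) c2 @N => // c' c2 N /f0N /(affine_level3 c2).
pose f : free_nilpotent n c -> affine n := @quotient_hom _ N _ (free_hom phi).
have fM : {morph f : a b / a * b} := quotient_homM fN.
have fx i : f (free_nilpotent_basis n c i) = phi i.
  by rewrite ffunE /f (quotient_hom_coset fN) /= free_hom_gen.
set x := free_nilpotent_basis n c in fx *.
have gx : generating_tuple x := free_nilpotent_basisP n c.
have gy := nontame_tuple_generating i10 (@free_nilpotent_gamma n c) gx.
have det1 : fox_det f x = 1%R.
  rewrite -(det1 _ n); congr determinant; apply/matrixP => i j.
  by rewrite !mxE fx mxE eqxx eq_sym.
have xz : [~ [~ x i0, x i1], x i1] =
    coset N [~ [~ freegroup_gen i0, freegroup_gen i1], freegroup_gen i1].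
  by rewrite !cosetR /x !ffunE.
(* The double commutator contributes the scalar [texp (-1) ^+ 2 * (1 - texp 1) ^+ 2], which is 4t^2
   since t^3 = 0. *)
have fz : (f (nontame_tuple x i0 i1 i0)).2 = (Trunc 1 0 4 *: delta_mx 0 i0)%R.
  rewrite set_entry_eq fM fx xz /f (quotient_hom_coset fN) /= !free_homR !free_hom_gen.
  rewrite !affine_commg /= subrr texp0 !scale0r !subr0 !scalerA.
  by rewrite -[X in (X + _)%R]scale1r -scalerDl.
have detE : fox_det f (nontame_tuple x i0 i1) = (Trunc 1 0 4 * fox_det f x)%R.
  apply: (@det_rows_scale _ _ _ i0); first by rewrite fz fx.
  by move=> k ki; rewrite set_entry_neq.
have := fox_det_reach fM (conn _ _ gx gy).
rewrite detE det1 mulr1 => -[+ _]; apply: (contra_not _ texp4_not_trivial_unit).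
by apply; exists false, 0%R; rewrite mul1r.
Qed.

Theorem theorem1p4 (n c : nat) (hn : (2 <= n)%N) (hc : (1 <= c)%N) :
  nielsen_graph_connected n (free_nilpotent n c) <-> (c = 1%N \/ c = 2%N).
Proof.
split=> [conn|[->|->]]; try exact: free_nilpotent_connected.
have [c2|/free_nilpotent_not_connected /(_ conn) []//] := leqP c 2.
by case: c hc c2 {conn} => [|[|[|]]] // _ _; [left|right].
Qed.
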